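(* For every positive integer $n$, the polynomial in $q$ $$\binom{2n}{n}_q\;-\;\prod_{i=1}^{n}\bigl(1+q^{2i-1}\bigr)\;=\;\sum_{k=0}^{n^2}\bigl(p_k(n,n)-b_k(n)\bigr)q^k$$ is symmetric and unimodal, i.e. its coefficients $c_k=p_k(n,n)-b_k(n)$ satisfy $c_k=c_{n^2-k}$ and $c_0\le c_1\le\cdots\le c_{\lfloor n^2/2\rfloor}\ge\cdots\ge c_{n^2}$.
   Context: $\binom{2n}{n}_q=\prod_{i=1}^{n}\frac{q^{n+i}-1}{q^i-1}$ is the Gaussian ($q$-binomial) coefficient, and $p_k(n,n)$ is the number of partitions of $k$ fitting inside an $n\times n$ square, so that $\binom{2n}{n}_q=\sum_k p_k(n,n)q^k$. $b_k(n)$ is the number of partitions of $k$ into distinct odd parts each at most $2n-1$, so that $\prod_{i=1}^n(1+q^{2i-1})=\sum_k b_k(n)q^k$. *)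

(* Defs.v *)
From mathcomp Require Import all_boot all_order all_algebra.
Set Implicit Arguments. Unset Strict Implicit. Unset Printing Implicit Defensive.
Import Order.TTheory GRing.Theory Num.Theory.

(* A partition fitting inside an n x n box is encoded as a weakly decreasing
   sequence of n parts lambda_0 >= ... >= lambda_{n-1}, each in {0,...,n}
   (zero parts padding). p_k(n,n) = number of such with sum k. *)
Definition box_partition (n : nat) (f : {ffun 'I_n -> 'I_n.+1}) : bool :=
  [forall i : 'I_n, forall j : 'I_n, (i <= j)%N ==> (nat_of_ord (f j) <= f i)%N].

Definition pbox (k n : nat) : nat :=
  #|[set f : {ffun 'I_n -> 'I_n.+1} | box_partition f &
       (\sum_(i < n) nat_of_ord (f i) == k)%N]|.

(* b_k(n) = number of partitions of k into distinct odd parts, each at most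
   2n-1: a set S of indices i in {0..n-1} giving parts 2i+1. *)
Definition bodd (k n : nat) : nat :=
  #|[set S : {set 'I_n} | (\sum_(i in S) (2 * i + 1) == k)%N]|.

Definition coef_c (n k : nat) : int := (pbox k n)%:Z - (bodd k n)%:Z.

(* Main.v *)
Require Import Defs.
From mathcomp Require Import all_boot all_order all_fingroup all_algebra.
From mathcomp Require Import realalg zify ring.
Import Order.TTheory GRing.Theory Num.Theory.
Local Open Scope ring_scope.
Set Implicit Arguments. Unset Strict Implicit. Unset Printing Implicit Defensive.

(* Partitions in the n x n box correspond, through their beta-sets, to the
   n-subsets S of {0, ..., 2n-1}, i.e. to the standard basis of the exterior
   power Lambda^n V, where V is the irreducible sl2-module of dimension 2n.
   Normalising V so that raising and lowering operators are adjoint, the raising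
   operator moves one element i of S to i + 1 with coefficient
   sqrt ((i + 1) (2n - 1 - i)) and no sign.  These coefficients are invariant
   under i |-> 2n - 2 - i, so raising commutes with conjugation of partitions,
   which on subsets is S |-> {x | 2n - 1 - x notin S}.  Hence raising acts on the
   functions that are odd under conjugation; in degree k they form a space of
   dimension (p_k - b_k) / 2, because b_k also counts the self-conjugate
   partitions of k in the box.  The commutation relation gives
   |raise f|^2 = |lower f|^2 + (n^2 - 2 k) |f|^2 in degree k, so raising is
   injective for 2 k < n^2, and p_k - b_k increases up to the middle.  Symmetry
   comes from reversing the subsets. *)

(** * Raising and lowering operators on subsets *)

Definition site_lo (m : nat) (i : 'I_m) : 'I_m.+1 := widen_ord (leqnSn m) i.
Definition site_hi (m : nat) (i : 'I_m) : 'I_m.+1 := lift ord0 i.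

(** Defined on every subset, legal move or not, so that it is an involution along which sums over
    subsets can be reindexed. *)
Definition hop (m : nat) (i : 'I_m) (S : {set 'I_m.+1}) : {set 'I_m.+1} :=
  [set x | tperm (site_lo i) (site_hi i) x \in S].

Definition can_rise (m : nat) (i : 'I_m) (S : {set 'I_m.+1}) : bool :=
  (site_lo i \in S) && (site_hi i \notin S).
Definition can_fall (m : nat) (i : 'I_m) (S : {set 'I_m.+1}) : bool :=
  (site_lo i \notin S) && (site_hi i \in S).

Definition weight (m : nat) (S : {set 'I_m.+1}) : nat := \sum_(x in S) x.

Lemma hopK (m : nat) (i : 'I_m) : involutive (hop i).
Proof. by move=> S; apply/setP => x; rewrite !inE tpermK. Qed.

Lemma can_fall_hop (m : nat) (i : 'I_m) (S : {set 'I_m.+1}) :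
  can_fall i (hop i S) = can_rise i S.
Proof. by rewrite /can_fall /can_rise !inE tpermL tpermR andbC. Qed.

Lemma can_rise_hop (m : nat) (i : 'I_m) (S : {set 'I_m.+1}) :
  can_rise i (hop i S) = can_fall i S.
Proof. by rewrite -can_fall_hop hopK. Qed.

Lemma hop_imset (m : nat) (i : 'I_m) (S : {set 'I_m.+1}) :
  hop i S = tperm (site_lo i) (site_hi i) @: S.
Proof.
apply/setP => x; rewrite inE -{2}[x](tpermK (site_lo i) (site_hi i)).
by rewrite mem_imset //; exact: perm_inj.
Qed.

Lemma card_hop (m : nat) (i : 'I_m) (S : {set 'I_m.+1}) : #|hop i S| = #|S|.
Proof. by rewrite hop_imset card_imset //; exact: perm_inj. Qed.

Lemma weight_hop (m : nat) (i : 'I_m) (S : {set 'I_m.+1}) :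
  can_fall i S -> weight S = (weight (hop i S)).+1.
Proof.
case/andP=> loS hiS; rewrite /weight (bigD1 (site_hi i)) //=.
rewrite [in RHS](bigD1 (site_lo i)) /= ?inE ?tpermL //.
rewrite -addSn; congr (_ + _)%N; apply: eq_bigl => x; rewrite inE.
case: tpermP => [->|->|/eqP xlo /eqP xhi].
- by rewrite (negbTE loS) eqxx andbF.
- by rewrite eqxx (negbTE loS) andbF.
- by rewrite xlo xhi.
Qed.

Section Ladder.
Variables (R : rcfType) (m : nat).
Implicit Types (i j : 'I_m) (S : {set 'I_m.+1}) (f : {set 'I_m.+1} -> R).

(** For adjacent [i], [j] both moves require the same state of the shared site and the first one
    changes it, so both sides vanish; otherwise the two transpositions are disjoint and commute. *)
Lemma hop_comm_exchange i j S f : i != j ->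
  (can_rise i S)%:R * (can_fall j (hop i S))%:R * f (hop j (hop i S)) =
  (can_fall j S)%:R * (can_rise i (hop j S))%:R * f (hop i (hop j S)).
Proof.
move=> ij; have ijn : (i != j :> nat) by [].
case: (eqVneq (i.+1) j) => [e|ne].
  have E : site_lo j = site_hi i by apply: val_inj.
  rewrite /can_rise /can_fall !inE E tpermR -{2}E tpermL.
  by case: (site_lo i \in S); case: (site_hi j \in S);
    rewrite /= ?(andbF, andFb, mul0r, mulr0).
case: (eqVneq (j.+1) i) => [e|ne'].
  have E : site_lo i = site_hi j by apply: val_inj.
  rewrite /can_rise /can_fall !inE -E tpermL {2}E tpermR.
  by case: (site_hi i \in S); case: (site_lo j \in S);
    rewrite /= ?(andbF, andFb, mul0r, mulr0).
have n1 : site_lo i != site_lo j by rewrite -val_eqE.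
have n2 : site_hi i != site_hi j by rewrite (inj_eq (@lift_inj _ ord0)).
have n3 : site_hi i != site_lo j by rewrite -val_eqE.
have n4 : site_lo i != site_hi j by rewrite -val_eqE eq_sym.
have -> : hop j (hop i S) = hop i (hop j S).
  apply/setP => x; rewrite !inE.
  congr (_ \in S); rewrite -!permM; congr (fun s : 'S_m.+1 => s x).
  by rewrite conjgC tpermJ !tpermD // eq_sym.
rewrite /can_rise /can_fall !inE !tpermD // 1?eq_sym //.
by congr (_ * _); exact: mulrC.
Qed.

Definition hop_coef i : R := Num.sqrt (i.+1 * (m - i))%:R.

(** The operator acts on functions: its value at [S] collects the sets from which [S] arises by a
    rise, hence the falls of [S]. *)
Definition raise f S : R :=
  \sum_i hop_coef i * (can_fall i S)%:R * f (hop i S).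
Definition lower f S : R :=
  \sum_i hop_coef i * (can_rise i S)%:R * f (hop i S).

Lemma raise_adjoint f g :
  \sum_S raise f S * g S = \sum_S f S * lower g S.
Proof.
under eq_bigr do rewrite /raise mulr_suml.
under [RHS]eq_bigr do rewrite /lower mulr_sumr.
rewrite exchange_big [RHS]exchange_big /=; apply: eq_bigr => i _.
rewrite (reindex_inj (inv_inj (@hopK m i))) /=; apply: eq_bigr => S _.
by rewrite can_fall_hop hopK; ring.
Qed.

(* The telescoping that makes [(i + 1) (m - i)] the right choice of squared
   coefficients: its successive differences are [m - 2 i]. *)
Lemma sum_hop_coef_diag S :
  \sum_(i < m) (i.+1 * (m - i))%:R * ((can_rise i S)%:R - (can_fall i S)%:R) =
  (m * #|S|)%:R - (2 * weight S)%:R :> R.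
Proof.
pose a k : R := (k * (m.+1 - k))%:R.
pose e (x : 'I_m.+1) : R := (x \in S)%:R.
transitivity (\sum_(i < m) a i.+1 * (e (site_lo i) - e (site_hi i))).
  apply: eq_bigr => i _; rewrite /a subSS /can_rise /can_fall /e; congr (_ * _).
  by case: (_ \in S); case: (_ \in S); rewrite /= ?subrr.
(* Summation by parts: [a] vanishes at [0] and at [m.+1], so both sums extend to all sites. *)
have lo : \sum_(i < m) a i.+1 * e (site_lo i) = \sum_(x < m.+1) a x.+1 * e x.
  by rewrite [RHS]big_ord_recr /= /a subnn muln0 mul0r addr0.
have hi : \sum_(i < m) a i.+1 * e (site_hi i) = \sum_(x < m.+1) a x * e x.
  by rewrite [RHS]big_ord_recl /= /a mul0n mul0r add0r.
under eq_bigr do rewrite mulrBr.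
rewrite sumrB lo hi -sumrB.
transitivity (\sum_(x in S) (m%:R - 2 * (x : nat)%:R : R)); last first.
  rewrite sumrB sumr_const -mulr_sumr -natr_sum natrM [(2 * _)%:R]natrM.
  by rewrite -[m%:R *+ _]mulr_natr.
rewrite big_mkcond [RHS]big_mkcond /=; apply: eq_bigr => x _.
rewrite /e; case: (x \in S); last by rewrite !mulr0 subrr.
rewrite !mulr1 /a subSS.
have xm : (x <= m)%N by rewrite -ltnS.
rewrite !natrM !natrB // ?(leqW xm) // -!natr1; ring.
Qed.

(** The terms moving at two distinct sites agree by [hop_comm_exchange]; the diagonal terms differ
    by the sum in [sum_hop_coef_diag]. *)
Lemma lower_raise f S :
  lower (raise f) S =
  raise (lower f) S + ((m * #|S|)%:R - (2 * weight S)%:R) * f S.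
Proof.
rewrite -sum_hop_coef_diag mulr_suml -big_split /lower /raise /=.
under eq_bigr => i _ do rewrite (bigD1 i) //= mulrDr mulr_sumr.
under [RHS]eq_bigr => i _ do rewrite (bigD1 i) //= mulrDr mulr_sumr.
rewrite big_split [RHS]big_split /= big_split /= -addrA [X in _ = _ + X]addrC addrA.
congr (_ + _).
  rewrite -big_split; apply: eq_bigr => i _ /=.
  rewrite can_fall_hop can_rise_hop hopK.
  have <- : hop_coef i ^+ 2 = (i.+1 * (m - i))%:R by rewrite sqr_sqrtr // ler0n.
  by case: (can_rise i S); case: (can_fall i S); rewrite /=; ring.
rewrite (exchange_big_dep predT) //=; apply: eq_bigr => j _.
apply: eq_big => [i|i ij]; first by rewrite eq_sym.
rewrite eq_sym in ij.
transitivity (hop_coef i * hop_coef j * ((can_rise i S)%:R *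
   (can_fall j (hop i S))%:R * f (hop j (hop i S)))); first by ring.
by rewrite hop_comm_exchange //; ring.
Qed.

(** * Raising below the middle weight *)

Definition slice (n k : nat) : {set {set 'I_m.+1}} :=
  [set S : {set 'I_m.+1} | (#|S| == n) && (weight S == k)].

Lemma raise_support f n k :
  (forall S, S \notin slice n k -> f S = 0) ->
  forall S, S \notin slice n k.+1 -> raise f S = 0.
Proof.
move=> fk S nS; rewrite /raise big1 // => i _.
have [fall|_] := boolP (can_fall i S); last by rewrite mulr0 mul0r.
rewrite fk ?mulr0 //; apply: contra nS.
by rewrite !inE card_hop (weight_hop fall).
Qed.

Lemma raise_inj f n k : (2 * k < m * n)%N ->
  (forall S, S \notin slice n k -> f S = 0) ->
  (forall S, raise f S = 0) -> forall S, f S = 0.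
Proof.
move=> kn fk Rf0.
have gap : 0 < (m * n)%:R - (2 * k)%:R :> R by rewrite subr_gt0 ltr_nat.
have : \sum_S raise f S * raise f S = 0.
  by apply: big1 => S _; rewrite Rf0 mulr0.
(* The squared norm of [raise f] becomes the pairing of [f] with [lower (raise f)]; on the support
   of [f] the commutator is the positive scalar [gap]. *)
rewrite raise_adjoint; under eq_bigr => S _.
  rewrite lower_raise mulrDr.
  have -> : f S * (((m * #|S|)%:R - (2 * weight S)%:R) * f S) =
            ((m * n)%:R - (2 * k)%:R) * (f S) ^+ 2.
    have [|/fk->] := boolP (S \in slice n k); last by rewrite expr0n /= !mulr0.
    by rewrite inE => /andP[/eqP-> /eqP->]; ring.
  over.
rewrite big_split /= -mulr_sumr.
under eq_bigr do rewrite mulrC.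
rewrite raise_adjoint => /eqP.
have ge0 : 0 <= \sum_S lower f S * lower f S.
  by apply: sumr_ge0 => S _; rewrite -expr2 sqr_ge0.
have ge0' : 0 <= \sum_S f S ^+ 2 by apply: sumr_ge0 => S _; rewrite sqr_ge0.
rewrite paddr_eq0 // ?mulr_ge0 ?(ltW gap) // mulf_eq0 (gt_eqF gap) /=.
case/andP=> _; rewrite psumr_eq0 => [/allP f0 S|S _]; last exact: sqr_ge0.
by have := f0 S (mem_index_enum S); rewrite /= sqrf_eq0 => /eqP.
Qed.

Lemma raise_sum (I : finType) (x : I -> R) (g : I -> {set 'I_m.+1} -> R) S :
  raise (fun U => \sum_a x a * g a U) S = \sum_a x a * raise (g a) S.
Proof.
rewrite /raise; under [RHS]eq_bigr do rewrite mulr_sumr.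
rewrite exchange_big /=; apply: eq_bigr => i _; rewrite mulr_sumr.
by apply: eq_bigr => a _; ring.
Qed.

(** * Conjugation of subsets *)

Definition conj_set S : {set 'I_m.+1} := [set x | rev_ord x \notin S].

Lemma conj_setK : involutive conj_set.
Proof. by move=> S; apply/setP => x; rewrite !inE rev_ordK negbK. Qed.

Lemma rev_site_lo i : rev_ord (site_lo i) = site_hi (rev_ord i).
Proof. by apply: val_inj; rewrite /= /bump /=; have := ltn_ord i; lia. Qed.

Lemma rev_site_hi i : rev_ord (site_hi i) = site_lo (rev_ord i).
Proof. by apply: (can_inj rev_ordK); rewrite rev_site_lo !rev_ordK. Qed.

Lemma hop_conj_set i S : hop i (conj_set S) = conj_set (hop (rev_ord i) S).
Proof.
apply/setP => x; rewrite !inE -rev_site_hi -rev_site_lo; congr (_ \notin S).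
by rewrite tpermC -(inj_tperm _ _ _ rev_ord_inj).
Qed.

Lemma raise_conj_set f S :
  raise f (conj_set S) = raise (fun U => f (conj_set U)) S.
Proof.
rewrite /raise (reindex_inj rev_ord_inj) /=; apply: eq_bigr => i _.
rewrite hop_conj_set rev_ordK; congr (_ * _ * _).
  by rewrite /hop_coef; congr (Num.sqrt _%:R); rewrite /=; have := ltn_ord i; nia.
rewrite /can_fall !inE rev_site_lo rev_site_hi rev_ordK negbK.
by rewrite andbC.
Qed.

End Ladder.

(** * Counting orbits of an involution by odd functions *)

Section InvolutionCount.
Variables (T : finType) (tau : T -> T).
Hypothesis tauK : involutive tau.

(** [enum_rank] only serves as a total order, to select one point of each two-element orbit. *)
Definition orbit_reps (A : {set T}) : {set T} :=
  [set s in A | (enum_rank s < enum_rank (tau s))%N].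
Definition fixed_in (A : {set T}) : {set T} := [set s in A | tau s == s].

Lemma card_orbit_reps (A : {set T}) : (forall s, (tau s \in A) = (s \in A)) ->
  #|A| = (2 * #|orbit_reps A| + #|fixed_in A|)%N.
Proof.
move=> tauA; set C := orbit_reps A.
have <- : #|tau @: C| = #|C| by rewrite card_imset //; exact: inv_inj.
rewrite -(cardsID (fixed_in A) A) addnC; congr (_ + _)%N; last first.
  by congr #|pred_of_set _|; apply/setP => s; rewrite !inE; case: (s \in A).
rewrite -(cardsID C) mul2n -addnn {2}card_imset; last exact: inv_inj.
rewrite addnC; congr (_ + _)%N; last first.
  congr #|pred_of_set _|; apply/setP => s; rewrite !inE.
  case: (s \in A); rewrite /= ?andbF //; case: eqVneq => [->|] //.
  by rewrite ltnn.
congr #|pred_of_set _|; apply/setP => s; rewrite -[in RHS](tauK s).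
rewrite mem_imset; last exact: inv_inj.
rewrite !inE tauK tauA; case: (s \in A); rewrite /= ?andbF //.
rewrite -leqNgt leq_eqVlt (inj_eq val_inj) (inj_eq enum_rank_inj).
by case: eqVneq => [->|ne] /=; rewrite ?ltnn ?andbT.
Qed.

(* [L] acts injectively on the odd functions supported in [A], a space whose
   dimension is the number of free orbits of [tau] in [A]. *)
Lemma leq_card_orbit_reps (F : fieldType) (A B : {set T})
    (L : (T -> F) -> T -> F) :
  (forall s, (tau s \in A) = (s \in A)) ->
  (2%:R != 0 :> F) ->
  (forall (I : finType) (x : I -> F) (g : I -> T -> F) t,
     L (fun s => \sum_a x a * g a s) t = \sum_a x a * L (g a) t) ->
  (forall f, (forall s, f (tau s) = - f s) ->
     forall t, L f (tau t) = - L f t) ->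
  (forall f, (forall s, s \notin A -> f s = 0) ->
     forall t, t \notin B -> L f t = 0) ->
  (forall f, (forall s, s \notin A -> f s = 0) ->
     (forall t, L f t = 0) -> forall s, f s = 0) ->
  (#|orbit_reps A| <= #|orbit_reps B|)%N.
Proof.
move=> tauA nz2 Lsum Lodd Lsupp Linj.
pose rep (a : 'I_#|orbit_reps A|) : T := enum_val a.
have repP a : (rep a \in A) && (enum_rank (rep a) < enum_rank (tau (rep a)))%N.
  by have := enum_valP a; rewrite inE.
(* The basis of the odd functions supported in [A], one for each free orbit. *)
pose g a s : F := (s == rep a)%:R - (s == tau (rep a))%:R.
have godd a s : g a (tau s) = - g a s.
  rewrite /g opprB (inj_eq (inv_inj tauK)); congr (_ - _%:R).
  by rewrite -{1}[rep a]tauK (inj_eq (inv_inj tauK)).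
pose M := \matrix_(a < #|orbit_reps A|, b < #|orbit_reps B|) L (g a) (enum_val b).
(* With more rows than columns, [M] has a nonzero left kernel vector [x]; the odd function [f] that
   it defines is nonzero, yet [L f] vanishes on the representatives of [B]. *)
rewrite leqNgt; apply/negP => lt_BA.
have : kermx M != 0.
  rewrite kermx_eq0 /row_free neq_ltn; apply/orP; left.
  exact: leq_ltn_trans (rank_leq_col M) lt_BA.
case/matrix0Pn => r [a0 xa0]; pose x a : F := kermx M r a.
have xM (b : 'I_#|orbit_reps B|) : \sum_a x a * L (g a) (enum_val b) = 0 :> F.
  transitivity ((kermx M *m M) r b); last by rewrite mulmx_ker mxE.
  by rewrite mxE; apply: eq_bigr => a _; rewrite [M a b]mxE.
pose f s := \sum_a x a * g a s.
have fodd s : f (tau s) = - f s.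
  by rewrite /f -sumrN; apply: eq_bigr => a _; rewrite godd mulrN.
have fsupp s : s \notin A -> f s = 0.
  move=> sA; apply: big1 => a _; rewrite /g.
  have /andP[aA _] := repP a.
  case: eqP => [e|_]; first by rewrite e aA in sA.
  case: eqP => [e|_]; first by rewrite e tauA aA in sA.
  by rewrite subrr mulr0.
have Lf0 t : L f t = 0.
  have Lreps u : u \in orbit_reps B -> L f u = 0.
    by move=> uB; rewrite Lsum -(enum_rankK_in uB uB) xM.
  have [tB|tB] := boolP (t \in B); last exact: Lsupp tB.
  have [sB|sB] := boolP (tau t \in B); last first.
    by rewrite -[t]tauK Lodd // (Lsupp _ fsupp _ sB) oppr0.
  case: (ltngtP (enum_rank t) (enum_rank (tau t))) => [lt|gt|e].
  - by apply: Lreps; rewrite inE tB.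
  - by rewrite -[t]tauK Lodd // Lreps ?oppr0 // inE sB tauK.
  (* At a fixed point of [tau] oddness gives twice the value equal to 0. *)
  - have := Lodd f fodd t; rewrite -(enum_rank_inj (val_inj e)) => /eqP.
    by rewrite -addr_eq0 -mulr2n -mulr_natl mulf_eq0 (negbTE nz2) /= => /eqP.
have /negP := xa0; apply; rewrite -/(x a0).
have := Linj f fsupp Lf0 (rep a0); rewrite /f (bigD1 a0) //= big1 => [|a ne].
  rewrite addr0 /g eqxx; have /andP[_] := repP a0.
  by case: eqP => [<-|_ _]; rewrite ?ltnn // subr0 mulr1 => ->.
rewrite /g; case: eqP => [/enum_val_inj e|_]; first by rewrite e eqxx in ne.
case: eqP => [e|_]; last by rewrite subrr mulr0.
have /andP[_ lt0] := repP a0; have /andP[_ lt1] := repP a.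
by move: lt0; rewrite e tauK ltnNge (ltnW lt1).
Qed.

End InvolutionCount.

(** * Reversal, conjugation and beta-sets *)

(** The weight of the beta-set of the empty partition. *)
Definition staircase (n : nat) : nat := \sum_(i < n) i.

Lemma staircase_double (n : nat) : (2 * staircase n + n = n * n)%N.
Proof.
elim: n => [|n IHn]; first by rewrite /staircase big_ord0.
by rewrite /staircase big_ord_recr /= -/(staircase n); lia.
Qed.

Lemma sum_rev_ord (n : nat) : (\sum_(i < n) rev_ord i)%N = staircase n.
Proof. by rewrite /staircase [RHS](reindex_inj rev_ord_inj). Qed.

Section SetSymmetries.
Variables (m : nat).
Implicit Type S : {set 'I_m.+1}.

Definition rev_set S : {set 'I_m.+1} := [set x | rev_ord x \in S].

Lemma rev_setK : involutive rev_set.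
Proof. by move=> S; apply/setP => x; rewrite !inE rev_ordK. Qed.

Lemma rev_setE S : rev_set S = @rev_ord m.+1 @: S.
Proof.
apply/setP => x; rewrite inE -[in RHS](rev_ordK x) mem_imset //.
exact: rev_ord_inj.
Qed.

Lemma card_rev_set S : #|rev_set S| = #|S|.
Proof. by rewrite rev_setE card_imset //; exact: rev_ord_inj. Qed.

Lemma weight_rev_set S : (weight (rev_set S) + weight S = m * #|S|)%N.
Proof.
rewrite /weight rev_setE big_imset /=; last by move=> x y _ _; exact: rev_ord_inj.
rewrite -big_split /= (eq_bigr (fun=> m)) => [|x _].
  by rewrite sum_nat_const mulnC.
by have := ltn_ord x; lia.
Qed.

Lemma conj_setE S : conj_set S = ~: rev_set S.
Proof. by apply/setP => x; rewrite !inE. Qed.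

Lemma conj_rev_set S : conj_set (rev_set S) = rev_set (conj_set S).
Proof. by apply/setP => x; rewrite !inE. Qed.

Lemma card_conj_set S : (#|conj_set S| + #|S| = m.+1)%N.
Proof. by rewrite conj_setE -(card_rev_set S) addnC cardsC card_ord. Qed.

Lemma weight_conj_set S :
  (weight (conj_set S) + m * #|S| = weight S + staircase m.+1)%N.
Proof.
suff : (weight (rev_set S) + weight (conj_set S) = staircase m.+1)%N.
  by have := weight_rev_set S; lia.
rewrite conj_setE /weight /staircase [RHS](bigID (mem (rev_set S))) /=.
by congr (_ + _)%N; apply: eq_bigl => x; rewrite !inE.
Qed.

(** The weight is kept because [m * n = staircase m.+1] when [m.+1 = 2 * n]. *)
Lemma conj_set_slice n w S : m.+1 = (2 * n)%N ->
  (conj_set S \in slice m n w) = (S \in slice m n w).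
Proof.
move=> mn; rewrite !inE.
have cS := card_conj_set S; have wS := weight_conj_set S.
have tm := staircase_double m.+1.
have -> : (#|conj_set S| == n) = (#|S| == n) by lia.
by case: eqP => //= e; rewrite e in wS; have -> : weight (conj_set S) = weight S by nia.
Qed.

(** The predicate [P] lets one argument serve both [pbox] and [bodd]. *)
Lemma card_slice_rev (P : pred {set 'I_m.+1}) n w : (w <= m * n)%N ->
  (forall S, P (rev_set S) = P S) ->
  #|[set S in slice m n w | P S]| = #|[set S in slice m n (m * n - w) | P S]|.
Proof.
move=> wmn Prev; rewrite -(card_imset _ (inv_inj rev_setK)).
congr #|pred_of_set _|; apply/setP => S.
rewrite -{1}[S]rev_setK mem_imset; last exact: inv_inj rev_setK.
rewrite !inE card_rev_set Prev; have := weight_rev_set S.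
by case: (P S); rewrite ?andbF ?andbT //; case: eqP => //= -> ?; lia.
Qed.

End SetSymmetries.

(** * Partitions in the box as subsets *)

Section BetaSet.
Variables (n m : nat).
Hypothesis mn : m.+1 = (2 * n)%N.
Implicit Type f : {ffun 'I_n -> 'I_n.+1}.

(* The beta-set (first-column hook lengths) of the partition [f]. *)
Definition beta_set f : {set 'I_m.+1} :=
  [set inord (f i + rev_ord i) | i : 'I_n].

Lemma val_beta f (i : 'I_n) :
  nat_of_ord (inord (f i + rev_ord i) : 'I_m.+1) = (f i + rev_ord i)%N.
Proof. rewrite inordK //=; have := ltn_ord (f i); have := ltn_ord i; lia. Qed.

Lemma box_partitionP f :
  reflect (forall i j : 'I_n, (i <= j)%N -> (f j <= f i)%N) (box_partition f).
Proof.
apply: (iffP forallP) => [fP i j ij|fP i]; first by have/forallP/(_ j)/implyP := fP i; apply.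
by apply/forallP => j; apply/implyP; exact: fP.
Qed.

Lemma beta_sorted f : box_partition f ->
  sorted gtn [seq (f i + rev_ord i)%N | i <- enum 'I_n].
Proof.
move/box_partitionP => fP; rewrite sorted_map.
have : sorted ltn (map val (enum 'I_n)) by rewrite val_enum_ord iota_ltn_sorted.
rewrite sorted_map; apply: sub_sorted => i j /= ij.
have := fP i j (ltnW ij); have := ltn_ord j; lia.
Qed.

Lemma beta_inj f : box_partition f ->
  injective (fun i : 'I_n => inord (f i + rev_ord i) : 'I_m.+1).
Proof.
move=> /box_partitionP fP i j /(congr1 (@nat_of_ord _)); rewrite !val_beta /= => e.
apply: val_inj => /=.
have := ltn_ord i; have := ltn_ord j.
by case: (ltngtP i j) => // ij; have := fP _ _ (ltnW ij); lia.
Qed.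

Lemma card_beta_set f : box_partition f -> #|beta_set f| = n.
Proof. by move/beta_inj=> fI; rewrite card_imset // card_ord. Qed.

Lemma weight_beta_set f : box_partition f ->
  weight (beta_set f) = (\sum_(i < n) f i + staircase n)%N.
Proof.
move=> /beta_inj fI; rewrite /weight big_imset /=; last by move=> i j _ _ /fI.
by rewrite -sum_rev_ord -big_split; apply: eq_bigr => i _; rewrite val_beta.
Qed.

(** A strictly decreasing sequence is determined by its set of values. *)
Lemma beta_set_inj : {in [pred f | box_partition f] &, injective beta_set}.
Proof.
move=> f g; rewrite !inE => fP gP /setP e.
have /eq_in_map E : [seq (f i + rev_ord i)%N | i <- enum 'I_n] =
           [seq (g i + rev_ord i)%N | i <- enum 'I_n].
  apply: (irr_sorted_eq (leT := gtn)).
  - by move=> x y z /=; lia.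
  - by move=> x /=; rewrite ltnn.
  - exact: beta_sorted.
  - exact: beta_sorted.
  have mem_beta (h : {ffun 'I_n -> 'I_n.+1}) x :
      (x \in [seq (h i + rev_ord i)%N | i <- enum 'I_n]) =
      (x <= m)%N && (inord x \in beta_set h).
    apply/mapP/andP => [[i _ ->]|[xm /imsetP[i _ xi]]].
      by split; [rewrite -ltnS -val_beta ltn_ord|apply/imsetP; exists i].
    exists i; rewrite ?mem_enum //.
    by have := congr1 (@nat_of_ord _) xi; rewrite val_beta inordK.
  by move=> x; rewrite !mem_beta e.
apply/ffunP => i; apply: val_inj => /=.
by have := E i (mem_enum _ _); lia.
Qed.

Lemma beta_set_surj (S : {set 'I_m.+1}) : #|S| = n ->
  exists2 f, box_partition f & beta_set f = S.
Proof.
move=> cS; pose s := map val (enum S).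
have size_s : size s = n by rewrite size_map -cardE.
have sorted_s : sorted ltn s.
  have : sorted ltn (map val (enum 'I_m.+1)) by rewrite val_enum_ord iota_ltn_sorted.
  rewrite /s !sorted_map => /(sorted_filter (leT := relpre val ltn)) H.
  rewrite {1}/enum_mem; apply: H.
  by move=> x y z /=; exact: ltn_trans.
(* Subtracting its index from each element of [s] recovers the parts; [gap] makes them nonnegative,
   monotone and, by comparison with the last element, at most [n]. *)
have gap a d : (a + d < n)%N -> (nth 0 s a + d <= nth 0 s (a + d))%N.
  elim: d => [|d IHd] adn; first by rewrite !addn0.
  have := IHd ltac:(lia); rewrite !addnS.
  have := @sorted_ltn_nth _ ltn ltn_trans 0%N s sorted_s (a + d)%N (a + d).+1.
  rewrite !inE size_s => /(_ ltac:(lia) ltac:(lia) (ltnSn _)) /=; lia.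
have in_s a : (a < n)%N -> (nth 0 s a <= m)%N /\ inord (nth 0 s a) \in S.
  rewrite -size_s => /(mem_nth 0)/mapP[x]; rewrite mem_enum => xS ->.
  by rewrite inord_val -ltnS ltn_ord.
have low a : (a < n)%N -> (a <= nth 0 s a)%N.
  by move=> an; have := gap 0%N a an; rewrite add0n; lia.
have high a : (a < n)%N -> (nth 0 s a <= n + a)%N.
  move=> an; have := gap a (n.-1 - a)%N ltac:(lia).
  rewrite subnKC; last by lia.
  have [] := in_s n.-1 ltac:(lia); lia.
pose f : {ffun 'I_n -> 'I_n.+1} := [ffun i => inord (nth 0 s (rev_ord i) - rev_ord i)].
have fE i : f i = (nth 0 s (rev_ord i) - rev_ord i)%N :> nat.
  by rewrite ffunE inordK // ltnS leq_subLR addnC high.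
have fP : box_partition f.
  apply/box_partitionP => i j ij; rewrite !fE.
  have := ltn_ord i; have := ltn_ord j => jn iltn.
  have := gap (rev_ord j) (rev_ord i - rev_ord j)%N ltac:(rewrite /=; lia).
  rewrite subnKC /=; last by lia.
  lia.
exists f => //; apply/eqP; rewrite eqEcard card_beta_set // cS leqnn andbT.
apply/subsetP => x /imsetP[i _ ->]; rewrite fE subnK ?low //.
by case: (in_s _ (ltn_ord (rev_ord i))).
Qed.

Lemma pbox_slice k : pbox k n = #|slice m n (k + staircase n)|.
Proof.
rewrite /pbox -(card_in_imset (f := beta_set)); last first.
  by move=> f g; rewrite !inE => /andP[fP _] /andP[gP _]; exact: beta_set_inj.
congr #|pred_of_set _|; apply/setP => S; rewrite inE.
apply/imsetP/andP => [[f]|[/eqP cS /eqP wS]].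
  rewrite inE => /andP[fP /eqP fk] ->.
  by rewrite card_beta_set // weight_beta_set // fk !eqxx.
have [f fP fS] := beta_set_surj cS; exists f => //.
by rewrite inE fP -(eqn_add2r (staircase n)) -weight_beta_set // fS wS eqxx.
Qed.

End BetaSet.

(** * Self-conjugate partitions *)

Section SelfConjugate.
Variable p : nat.
Let n := p.+1.
(** In this form [m.+1] is convertible to [n + n], so [split], [lshift] and [rshift] apply to the
    sites. *)
Let m := (p + p.+1)%N.
Implicit Type Q : {set 'I_n}.

Lemma rev_lshift (i : 'I_n) :
  rev_ord (lshift n i) = rshift n (rev_ord i) :> 'I_(n + n).
Proof. by apply: val_inj; rewrite /= addnBA. Qed.

Lemma rev_rshift (i : 'I_n) :
  rev_ord (rshift n i) = lshift n (rev_ord i) :> 'I_(n + n).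
Proof. by apply: (can_inj rev_ordK); rewrite rev_lshift !rev_ordK. Qed.

(* [Q] lists the diagonal hooks [2 i + 1] of a self-conjugate partition; its
   beta-set picks one site from each pair [n + i], [n - 1 - i]. *)
Definition hook_set Q : {set 'I_m.+1} :=
  [set x : 'I_(n + n) | match split x with
                        | inl i => rev_ord i \notin Q
                        | inr i => i \in Q
                        end].

Lemma lshift_hook_set Q (i : 'I_n) :
  (lshift n i \in hook_set Q) = (rev_ord i \notin Q).
Proof. by rewrite inE (unsplitK (inl i)). Qed.

Lemma rshift_hook_set Q (i : 'I_n) : (rshift n i \in hook_set Q) = (i \in Q).
Proof. by rewrite inE (unsplitK (inr i)). Qed.

Lemma conj_hook_set Q : conj_set (hook_set Q) = hook_set Q.
Proof.
apply/setP => x; rewrite in_set.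
case: (split_ordP (x : 'I_(n + n))) => i ->.
  by rewrite rev_lshift rshift_hook_set lshift_hook_set.
by rewrite rev_rshift lshift_hook_set rshift_hook_set rev_ordK negbK.
Qed.

Lemma card_hook_set Q : #|hook_set Q| = n.
Proof. by have := card_conj_set (hook_set Q); rewrite conj_hook_set /m /n; lia. Qed.

(** Choosing [n + i] instead of [n - 1 - i] adds [2 * i + 1]; the empty [Q] gives the sites below
    [n]. *)
Lemma weight_hook_set Q :
  weight (hook_set Q) = (\sum_(i in Q) (2 * i + 1) + staircase n)%N.
Proof.
rewrite /weight big_mkcond (@big_split_ord _ _ _ n n) /=.
rewrite -sum_rev_ord [X in (_ + X)%N = _]big_mkcond (reindex_inj rev_ord_inj).
rewrite -big_split [X in _ = (X + _)%N]big_mkcond -big_split.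
apply: eq_bigr => i _; rewrite lshift_hook_set rshift_hook_set rev_ordK /=.
by have := ltn_ord i; rewrite /n; case: (i \in Q) => /=; lia.
Qed.

Lemma hook_set_inj : injective hook_set.
Proof. by move=> Q Q' /setP e; apply/setP => i; rewrite -!rshift_hook_set e. Qed.

Lemma hook_set_surj (S : {set 'I_m.+1}) : conj_set S = S -> exists Q, hook_set Q = S.
Proof.
move=> SS; exists [set i | rshift n i \in S]; apply/setP => x.
case: (split_ordP (x : 'I_(n + n))) => i ->.
  by rewrite lshift_hook_set inE -[in RHS]SS inE rev_lshift.
by rewrite rshift_hook_set inE.
Qed.

Lemma bodd_slice k :
  bodd k n = #|fixed_in (@conj_set m) (slice m n (k + staircase n))|.
Proof.
rewrite /bodd -(card_imset _ hook_set_inj); congr #|pred_of_set _|.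
apply/setP => S; rewrite !inE; apply/imsetP/andP => [[Q]|[/andP[_ /eqP wS] /eqP SS]].
  rewrite inE => /eqP Qk ->.
  by rewrite card_hook_set weight_hook_set conj_hook_set Qk !eqxx.
have [Q QS] := hook_set_surj SS; exists Q => //.
by rewrite inE -(eqn_add2r (staircase n)) -weight_hook_set QS wS.
Qed.

End SelfConjugate.

(** * Unimodality *)

Lemma leq_orbit_reps_slice (m n w : nat) : m.+1 = (2 * n)%N ->
  (2 * w < m * n)%N ->
  (#|orbit_reps (@conj_set m) (slice m n w)| <=
   #|orbit_reps (@conj_set m) (slice m n w.+1)|)%N.
Proof.
move=> mn wmn.
(* [realalg] is ordered and contains the square roots in [hop_coef]. *)
apply: (leq_card_orbit_reps (@conj_setK m) (L := @raise realalg m)).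
- by move=> S; exact: conj_set_slice.
- by rewrite pnatr_eq0.
- exact: raise_sum.
- move=> f fodd S; rewrite raise_conj_set /raise -sumrN.
  by apply: eq_bigr => i _; rewrite fodd mulrN.
- by move=> f; exact: raise_support.
- by move=> f; exact: raise_inj.
Qed.

Lemma coef_c_slice (p k : nat) (n := p.+1) (m := (p + p.+1)%N) :
  coef_c n k =
  (2 * #|orbit_reps (@conj_set m) (slice m n (k + staircase n))|)%:Z.
Proof.
have mn : m.+1 = (2 * n)%N by rewrite /m /n; lia.
rewrite /coef_c (pbox_slice mn) bodd_slice -/m -/n.
rewrite (card_orbit_reps (@conj_setK m) (A := slice m n _)).
  by rewrite PoszD addrK.
by move=> S; exact: conj_set_slice.
Qed.

Lemma coef_c_sym (p k : nat) (n := p.+1) :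
  (k <= n ^ 2)%N -> coef_c n k = coef_c n (n ^ 2 - k).
Proof.
move=> kn; pose m := (p + p.+1)%N.
have mn : m.+1 = (2 * n)%N by rewrite /m /n; lia.
have tn := staircase_double n.
rewrite /coef_c !(pbox_slice mn) !bodd_slice -/m -/n.
have e : (n ^ 2 - k + staircase n = m * n - (k + staircase n))%N by nia.
have le : (k + staircase n <= m * n)%N by nia.
congr (Posz _ - Posz _); rewrite e.
  have := @card_slice_rev m predT n _ le (fun=> erefl).
  by rewrite !setIdE !setIT.
apply: card_slice_rev => // S; rewrite conj_rev_set.
exact: inj_eq (inv_inj (@rev_setK m)) _ _.
Qed.

Lemma coef_c_incr (p k : nat) (n := p.+1) :
  (2 * k < n ^ 2)%N -> coef_c n k <= coef_c n k.+1.
Proof.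
move=> kn; have tn := staircase_double n.
rewrite !coef_c_slice lez_nat leq_mul2l /= addSn leq_orbit_reps_slice //; first lia.
(* As [m = 2 * n - 1] and [2 * staircase n = n * n - n], the bound on the weight [k + staircase n]
   amounts to [2 * k < n ^ 2]. *)
by move: kn tn; rewrite -mulnn /n; nia.
Qed.

Theorem theorem4p1 (n : nat) : (0 < n)%N ->
  (forall k : nat, (k <= n ^ 2)%N -> coef_c n k = coef_c n (n ^ 2 - k)) /\
  (forall k : nat, (k < (n ^ 2)./2)%N -> coef_c n k <= coef_c n k.+1) /\
  (forall k : nat, ((n ^ 2)./2 <= k)%N -> (k < n ^ 2)%N ->
      coef_c n k.+1 <= coef_c n k).
Proof.
case: n => // p _; set N := (p.+1 ^ 2)%N; split; last split.
- by move=> k; exact: coef_c_sym.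
- by move=> k kN; apply: coef_c_incr; rewrite -/N; lia.
(* Symmetry turns the step from [k] to [k.+1] into the one from [N - k.+1] to [N - k], in the
   increasing half. *)
move=> k kN ltkN; rewrite coef_c_sym // [leRHS]coef_c_sym ?(ltnW ltkN) // -/N.
have -> : (N - k = (N - k.+1).+1)%N by lia.
have [lt|ge] := ltnP (2 * (N - k.+1)) N; first exact: coef_c_incr.
lia.
Qed.
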